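(* \begin{enumerate} \item For all $d,k\in\mathbb{N}$ there is a constant $C_{d,k}$ such that for any set $P$ of $n_1$ points in $\mathbb{R}^d$ and any set $B$ of $n_2$ boxes in $\mathbb{R}^d$, if the incidence graph on $P\times B$ is $K_{k,k}$-free, then it has at most $C_{d,k}\, n\log^{2d}n$ incidences, where $n=n_1+n_2$. \item For all $k,s\in\mathbb{N}$ there is a constant $C_{k,s}$ such that the following holds. Let $d\in\mathbb{N}$ and let $H_1,\dots,H_s$ be (open or closed) half-spaces in $\mathbb{R}^d$, and let $\mathcal{F}$ be the family of all polytopes of the form $\bigcap_{i=1}^s(y_i+H_i)$ with $y_1,\dots,y_s\in\mathbb{R}^d$ arbitrary. For any set $P$ of $n_1$ points in $\mathbb{R}^d$ and any set $F$ of $n_2$ polytopes in $\mathcal{F}$, if the incidence graph on $P\times F$ is $K_{k,k}$-free, then it has at most $C_{k,s}\, n\log^s n$ incidences, where $n=n_1+n_2$. \end{enumerate}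
   Context: A box in $\mathbb{R}^d$ is a product of $d$ intervals (axis-parallel sides; open or closed). The incidence graph on $P\times F$ joins a point $p$ to a set $\phi$ iff $p\in\phi$; incidences are its edges. A bipartite graph is $K_{k,k}$-free if it contains no complete bipartite subgraph with $k$ vertices on each side. $y+H$ denotes the translate of $H$ by the vector $y$. *)

(* Defs.v *)
From mathcomp Require Import all_boot all_order all_algebra finmap.
From mathcomp Require Import all_classical all_reals all_analysis.

Set Implicit Arguments.
Unset Strict Implicit.
Unset Printing Implicit Defensive.

Import Order.TTheory GRing.Theory Num.Theory.

Local Open Scope classical_set_scope.
Local Open Scope ring_scope.

Definition incidence_graph (T : choiceType) (P : {fset T}) (F : {fset set T}) :
    {fset T * set T} :=
  [fset e in (P `*` F)%fset | e.1 \in e.2]%fset.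

(* E is the edge set of a bipartite graph with parts P and Q; a copy of K_{k,k}
   has its side A in P and its side B in Q. *)
Definition Kkk_free (T U : choiceType) (k : nat) (P : {fset T}) (Q : {fset U})
    (E : {fset T * U}) : Prop :=
  ~ exists (A : {fset T}) (B : {fset U}),
      [/\ (A `<=` P)%fset, (B `<=` Q)%fset, #|` A| = k, #|` B| = k
        & forall a b, a \in A -> b \in B -> (a, b) \in E].

(* The intervals may be open, closed or half-open, bounded or unbounded. *)
Definition is_box (R : realType) (d : nat) (B : set 'rV[R]_d) : Prop :=
  exists I : 'I_d -> interval R, B = [set x | forall i, x 0 i \in I i].

Definition dot (R : realType) (d : nat) (a x : 'rV[R]_d) : R :=
  \sum_(i < d) a 0 i * x 0 i.

Definition is_halfspace (R : realType) (d : nat) (H : set 'rV[R]_d) : Prop :=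
  exists (a : 'rV[R]_d) (b : R), a != 0 /\
    (H = [set x | dot a x <= b] \/ H = [set x | dot a x < b]).

Definition translate (R : realType) (d : nat) (y : 'rV[R]_d)
    (H : set 'rV[R]_d) : set 'rV[R]_d :=
  [set y + x | x in H].

Definition polytope_family (R : realType) (d s : nat)
    (H : 'I_s -> set 'rV[R]_d) : set (set 'rV[R]_d) :=
  [set Q | exists y : 'I_s -> 'rV[R]_d,
     Q = \bigcap_(i in [set: 'I_s]) translate (y i) (H i)].

(* Main.v *)
Require Import Defs.
From mathcomp Require Import all_boot all_order all_algebra finmap.
From mathcomp Require Import all_classical all_reals all_analysis.
From mathcomp Require Import zify.

(** Both families are of the following kind: the incidence relation is a
    conjunction of [s] relations, each of the form "key of [p] < key of [q]" for
    suitable natural keys below [2 ^ m], where [m = O(log n)] (for boxes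
    [s = 2 d], one relation per endpoint of each interval).  For such relations
    the bound [k * m ^ s * n] follows by halving the range of the keys of one
    relation: incidences inside the lower half and inside the upper half are
    counted recursively, there are none between upper [p] and lower [q], and
    between lower [p] and upper [q] the relation holds trivially, so that only
    [s - 1] relations remain.  Each of the [m] halving levels thus costs the
    bound for [s - 1] relations, and for [s = 0] the graph is complete
    bipartite, so that one side has fewer than [k] vertices. *)

Import Order.TTheory GRing.Theory Num.Theory.

Local Open Scope classical_set_scope.
Local Open Scope ring_scope.

Set Implicit Arguments.
Unset Strict Implicit.

(** * Bipartite graphs given by a relation *)

(** For [e p b := p \in b] this is convertible to [incidence_graph P Q], so bounds on [edges] apply
    directly to incidence graphs. *)
Definition edges (T U : choiceType) (e : T -> U -> bool) (P : {fset T})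
    (Q : {fset U}) : {fset T * U} :=
  [fset x in (P `*` Q)%fset | e x.1 x.2]%fset.

(* The sets [r ^~ q] form a chain under inclusion. *)
Definition ferrers (T U : Type) (r : T -> U -> bool) : Prop :=
  forall p p' q q', r p q -> r p' q' -> r p q' || r p' q.

Section Counting.
Local Open Scope nat_scope.
Variables T U : choiceType.
Implicit Types (e r : T -> U -> bool) (P : {fset T}) (Q : {fset U}).

Lemma in_edges e P Q (p : T) (q : U) :
  ((p, q) \in edges e P Q) = [&& p \in P, q \in Q & e p q].
Proof. by rewrite /edges !inE /= andbA. Qed.

Lemma eq_in_edges e e' P Q :
  (forall p q, p \in P -> q \in Q -> e p q = e' p q) ->
  edges e P Q = edges e' P Q.
Proof.
move=> ee'; apply/fsetP=> -[p q]; rewrite !in_edges.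
by case: (boolP (p \in P)) => //= pP; case: (boolP (q \in Q)) => //= qQ; apply: ee'.
Qed.

Lemma card_edges_le e P Q : #|` edges e P Q| <= #|` P| * #|` Q|.
Proof.
rewrite -(size_allpairs pair); apply: uniq_leq_size; first exact: fset_uniq.
by move=> [p q]; rewrite in_edges => /and3P[pP qQ _]; apply: allpairs_f.
Qed.

Lemma Kkk_free_sub k e P Q P' Q' : (P' `<=` P)%fset -> (Q' `<=` Q)%fset ->
  Kkk_free k P Q (edges e P Q) -> Kkk_free k P' Q' (edges e P' Q').
Proof.
move=> sP sQ free [A [B [AP BQ cA cB AB]]]; apply: free; exists A, B; split=> //.
- exact: fsubset_trans sP.
- exact: fsubset_trans sQ.
move=> a b aA bB; move: (AB a b aA bB); rewrite !in_edges => /and3P[aP bQ ->].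
by rewrite (fsubsetP sP) // (fsubsetP sQ).
Qed.

Lemma exists_fsubset_card (V : choiceType) (A : {fset V}) k : k <= #|` A| ->
  exists2 B : {fset V}, (B `<=` A)%fset & #|` B| = k.
Proof.
move=> kA; exists [fset x in take k (enum_fset A)]%fset.
  by apply/fsubsetP=> x; rewrite !inE => /mem_take.
by rewrite card_fseq undup_id ?take_uniq // size_takel.
Qed.

Lemma card_edges_complete k P Q :
  let e := fun _ _ => true in
  Kkk_free k P Q (edges e P Q) -> #|` edges e P Q| <= k * (#|` P| + #|` Q|).
Proof.
move=> e free; apply: leq_trans (card_edges_le _ _ _) _.
have [/ltnW Pk|kP] := ltnP #|` P| k.
  by rewrite mulnDr (leq_trans _ (leq_addl _ _)) // leq_mul2r Pk orbT.
have [/ltnW Qk|kQ] := ltnP #|` Q| k.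
  by rewrite mulnDr (leq_trans _ (leq_addr _ _)) // mulnC leq_mul2r Qk orbT.
have [A AP cA] := exists_fsubset_card kP.
have [B BQ cB] := exists_fsubset_card kQ.
case: free; exists A, B; split=> // a b aA bB.
by rewrite in_edges (fsubsetP AP) // (fsubsetP BQ).
Qed.

(** * Halving the range of a key *)

Lemma card_fset_split (V : choiceType) (A : {fset V}) (f : V -> nat) c :
  #|` [fset x in A | f x < c]%fset| + #|` [fset x in A | c <= f x]%fset|
  = #|` A|.
Proof.
rewrite -(cardfsID [fset x in A | f x < c]%fset A); congr addn.
  by congr (size (enum_fset _)); apply/fsetP=> x; rewrite !inE /= andbA andbb.
by congr (size (enum_fset _)); apply/fsetP=> x; rewrite !inE /= leqNgt; case: (x \in A); rewrite ?andbT ?andbF.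
Qed.

(** The fourth block, [Pr] against [Ql], is empty: there [g q < c <= f p]. *)
Lemma card_edges_key_split e (f : T -> nat) (g : U -> nat) c P Q :
  let e' := fun p q => (f p < g q) && e p q in
  let Pl := [fset p in P | f p < c]%fset in
  let Pr := [fset p in P | c <= f p]%fset in
  let Ql := [fset q in Q | g q < c]%fset in
  let Qr := [fset q in Q | c <= g q]%fset in
  #|` edges e' P Q| <=
    #|` edges e' Pl Ql| + #|` edges e' Pr Qr| + #|` edges e' Pl Qr|.
Proof.
rewrite /=; set e' := fun p q => (f p < g q) && e p q.
set Pl := [fset p in P | f p < c]%fset; set Pr := [fset p in P | c <= f p]%fset.
set Ql := [fset q in Q | g q < c]%fset; set Qr := [fset q in Q | c <= g q]%fset.
apply: (@leq_trans
  #|` (edges e' Pl Ql `|` edges e' Pr Qr `|` edges e' Pl Qr)%fset|).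
  apply/fsubset_leq_card/fsubsetP=> -[p q].
  rewrite in_fsetU in_fsetU !in_edges !inE /= /e' => /and3P[-> -> /andP[fg ->]].
  by rewrite fg /=; lia.
apply: leq_trans (leq_card_fsetU _ _) _.
by rewrite leq_add2r leq_card_fsetU.
Qed.

(** Induction on [m]; the left end [a] of the key range varies because the upper half starts at
    [a + 2 ^ m]. The bound for [e] is assumed only on subsets of [P] and [Q], since the remaining
    keys are controlled only there. *)
Lemma card_edges_key_le k A e (f : T -> nat) (g : U -> nat) P Q :
  (forall P' Q', (P' `<=` P)%fset -> (Q' `<=` Q)%fset ->
     Kkk_free k P' Q' (edges e P' Q') ->
     #|` edges e P' Q'| <= A * (#|` P'| + #|` Q'|)) ->
  let e' := fun p q => (f p < g q) && e p q in
  forall m a P' Q', (P' `<=` P)%fset -> (Q' `<=` Q)%fset ->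
    (forall p, p \in P' -> a <= f p < a + 2 ^ m) ->
    (forall q, q \in Q' -> a <= g q < a + 2 ^ m) ->
    Kkk_free k P' Q' (edges e' P' Q') ->
    #|` edges e' P' Q'| <= A * m * (#|` P'| + #|` Q'|).
Proof.
move=> bnd e'; elim=> [|m IHm] a P' Q' sP sQ fa ga free.
  (* A range of length [2 ^ 0] forces all keys to equal [a], so the strict inequality never
     holds. *)
  have -> : edges e' P' Q' = fset0.
    apply/fsetP=> -[p q]; rewrite in_edges inE; apply/negP=> /and3P[pP qQ].
    by move: (fa _ pP) (ga _ qQ); rewrite expn0 /e'; lia.
  by rewrite cardfs0.
set c := a + 2 ^ m.
have := @card_edges_key_split e f g c P' Q'; rewrite /= -/e'.
set Pl := [fset p in P' | f p < c]%fset; set Pr := [fset p in P' | c <= f p]%fset.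
set Ql := [fset q in Q' | g q < c]%fset; set Qr := [fset q in Q' | c <= g q]%fset.
move=> split.
have sPl : (Pl `<=` P')%fset by apply: fset_sub.
have sPr : (Pr `<=` P')%fset by apply: fset_sub.
have sQl : (Ql `<=` Q')%fset by apply: fset_sub.
have sQr : (Qr `<=` Q')%fset by apply: fset_sub.
have Hl : #|` edges e' Pl Ql| <= A * m * (#|` Pl| + #|` Ql|).
  apply: (IHm a); rewrite ?(fsubset_trans _ sP) ?(fsubset_trans _ sQ) //.
  - by move=> p; rewrite !inE /= => /andP[/fa /andP[-> _] ->].
  - by move=> q; rewrite !inE /= => /andP[/ga /andP[-> _] ->].
  - exact: Kkk_free_sub free.
have Hr : #|` edges e' Pr Qr| <= A * m * (#|` Pr| + #|` Qr|).
  apply: (IHm c); rewrite ?(fsubset_trans _ sP) ?(fsubset_trans _ sQ) //.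
  - move=> p; rewrite !inE /= => /andP[/fa]; rewrite /c expnS; lia.
  - move=> q; rewrite !inE /= => /andP[/ga]; rewrite /c expnS; lia.
  - exact: Kkk_free_sub free.
(* This equality serves twice: it replaces the graph to be counted and carries the freeness from
   [e'] over to [e], as [bnd] requires. *)
have Elr : edges e' Pl Qr = edges e Pl Qr.
  apply: eq_in_edges => p q; rewrite !inE /= /e' => /andP[_ fp] /andP[_ gq].
  by rewrite (leq_trans fp gq).
have Hlr : #|` edges e' Pl Qr| <= A * (#|` P'| + #|` Q'|).
  rewrite Elr; apply: (@leq_trans (A * (#|` Pl| + #|` Qr|))).
    apply: bnd; rewrite ?(fsubset_trans _ sP) ?(fsubset_trans _ sQ) //.
    by rewrite -Elr; apply: Kkk_free_sub free.
  by rewrite leq_mul2l leq_add ?orbT // fsubset_leq_card.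
have cP := card_fset_split P' f c; have cQ := card_fset_split Q' g c.
rewrite -/Pl -/Pr in cP; rewrite -/Ql -/Qr in cQ.
(* The crossing block accounts for the extra [A] in [A * m.+1]. The two recursive bounds add up
   without loss, because the halves partition [P'] and [Q']. *)
apply: leq_trans split _; rewrite mulnS mulnDl addnC leq_add //.
by rewrite -cP -cQ addnACA mulnDr leq_add.
Qed.

Definition keys_rel (ks : seq ((T -> nat) * (U -> nat))) (p : T) (q : U) :=
  all (fun k => k.1 p < k.2 q) ks.

Lemma card_edges_keys_le k m ks P Q :
  (forall i, i < size ks -> forall p, p \in P ->
     (nth (fun=> 0, fun=> 0) ks i).1 p < 2 ^ m) ->
  (forall i, i < size ks -> forall q, q \in Q ->
     (nth (fun=> 0, fun=> 0) ks i).2 q < 2 ^ m) ->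
  Kkk_free k P Q (edges (keys_rel ks) P Q) ->
  #|` edges (keys_rel ks) P Q| <= k * m ^ size ks * (#|` P| + #|` Q|).
Proof.
elim: ks P Q => [|[f g] ks IH] P Q fm gm free /=.
  by rewrite expn0 muln1; apply: card_edges_complete.
rewrite expnSr mulnA; apply: (@card_edges_key_le _ _ _ f g P Q _ m 0) => //.
- move=> P' Q' sP sQ; apply: IH => i i_lt v.
    by move/(fsubsetP sP); apply: (fm i.+1).
  by move/(fsubsetP sQ); apply: (gm i.+1).
- exact: (fm 0).
- exact: (gm 0).
- exact: free.
Qed.

(** * Natural keys for Ferrers relations *)

(** The key of [p] counts its non-neighbours in [Q]; the key of [q] is one more than the largest key
    of a neighbour of [q] in [P], and 0 if there is none. *)
Lemma ferrers_keys r P Q : ferrers r ->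
  exists fg : (T -> nat) * (U -> nat),
    [/\ forall p q, p \in P -> q \in Q -> r p q = (fg.1 p < fg.2 q),
        forall p, fg.1 p <= #|` Q| & forall q, fg.2 q <= #|` Q|.+1].
Proof.
move=> rF; pose f p := count (fun q => ~~ r p q) (enum_fset Q).
pose g q := \max_(p <- enum_fset P | r p q) (f p).+1.
have fQ p : f p <= #|` Q| by apply: count_size.
exists (f, g); split=> //= [p q pP qQ|q]; last by apply/bigmax_leqP_seq => p _ _; rewrite ltnS.
case: (boolP (r p q)) => rpq; apply/esym.
  exact: (@leq_bigmax_seq _ (enum_fset P) (r ^~ q) (fun p => (f p).+1)).
apply/negbTE; rewrite -leqNgt; apply/bigmax_leqP_seq => p' _ rp'q.
(* If [p'] is a neighbour of [q] and [p] is not, then [f p' < f p]: by the Ferrers property every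
   non-neighbour of [p'] is one of [p], and [q] is a further one, appended here by [rcons]. *)
rewrite /f -!size_filter -(size_rcons _ q).
apply: uniq_leq_size.
  rewrite rcons_uniq mem_filter rp'q /=; exact/filter_uniq/fset_uniq.
move=> x; rewrite mem_rcons inE => /orP[/eqP->|]; rewrite !mem_filter ?rpq ?qQ //.
case/andP=> nrx ->; rewrite andbT; apply/negP=> rpx.
by have := rF _ _ _ _ rpx rp'q; rewrite (negbTE rpq) (negbTE nrx).
Qed.

Lemma ferrers_seq_keys (rs : seq (T -> U -> bool)) P Q :
  (forall i, i < size rs -> ferrers (nth (fun _ _ => true) rs i)) ->
  exists ks : seq ((T -> nat) * (U -> nat)),
    [/\ size ks = size rs,
        forall p q, p \in P -> q \in Q ->
          all (fun r => r p q) rs = keys_rel ks p q,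
        forall i, i < size ks -> forall p,
          (nth (fun=> 0, fun=> 0) ks i).1 p <= #|` Q| &
        forall i, i < size ks -> forall q,
          (nth (fun=> 0, fun=> 0) ks i).2 q <= #|` Q|.+1].
Proof.
elim: rs => [|r rs IH] rF; first by exists [::].
have [ks [sz E f_le g_le]] := IH (fun i => rF i.+1).
have [fg [Efg f_le0 g_le0]] := ferrers_keys P Q (rF 0 isT).
exists (fg :: ks); split=> [|p q pP qQ|[|i]|[|i]] //=; first by rewrite sz.
- by rewrite -Efg // E.
- exact: f_le.
- exact: g_le.
Qed.

Lemma card_edges_ferrers k (rs : seq (T -> U -> bool)) e P Q :
  (forall i, i < size rs -> ferrers (nth (fun _ _ => true) rs i)) ->
  (forall p q, p \in P -> q \in Q -> e p q = all (fun r => r p q) rs) ->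
  Kkk_free k P Q (edges e P Q) ->
  let n := #|` P| + #|` Q| in
  #|` edges e P Q| <= k * (trunc_log 2 n).+1 ^ size rs * n.
Proof.
move=> rF Ee free /=; set n := #|` P| + #|` Q|.
(* A nonempty [P] gives [#|] Q| + 1 <= n[, which keeps the keys, at most]#|[Q| + 1], below the power
   of two following [n]. *)
have [P0|P_neq0] := eqVneq P fset0.
  by apply: leq_trans (card_edges_le _ _ _) _; rewrite P0 cardfs0.
have Qn : #|` Q|.+1 < 2 ^ (trunc_log 2 n).+1.
  apply: (@leq_trans n.+1); last exact: trunc_log_ltn.
  by rewrite ltnS /n -[X in X < _]add0n ltn_add2r cardfs_gt0.
have [ks [sz E f_le g_le]] := @ferrers_seq_keys rs P Q rF.
have EE : edges e P Q = edges (keys_rel ks) P Q.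
  by apply: eq_in_edges => p q pP qQ; rewrite Ee // E.
rewrite EE -sz; apply: card_edges_keys_le; last by rewrite -EE.
- by move=> i i_lt p _; apply: leq_ltn_trans (f_le _ i_lt _) (ltnW Qn).
- by move=> i i_lt q _; apply: leq_ltn_trans (g_le _ i_lt _) Qn.
Qed.

End Counting.

(** * From binary to natural logarithms *)

(** For [t = trunc_log 2 n] one has [t + 1 <= 2 * t], as [t >= 1], and [t * ln 2 <= ln n], as
    [2 ^ t <= n]. *)
Lemma trunc_logS_le_ln (R : realType) (n : nat) : (1 < n)%N ->
  ((trunc_log 2 n).+1)%:R <= 2 / ln (2 : R) * ln (n%:R : R).
Proof.
move=> n_gt1; have ln2 : 0 < ln (2 : R) by rewrite ln_gt0 // ltr1n.
rewrite mulrAC ler_pdivlMr //.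
apply: (@le_trans _ _ (2 * (trunc_log 2 n)%:R * ln 2)).
  rewrite ler_pM2r // -natrM ler_nat.
  have : (0 < trunc_log 2 n)%N by apply: trunc_log_max.
  lia.
rewrite -mulrA ler_pM2l // mulr_natl -lnXn // ler_ln ?posrE ?exprn_gt0 ?ltr0n //.
  by rewrite -natrX ler_nat trunc_logP // ltnW.
exact: ltnW.
Qed.

(** The vertex types are quantified after [C], so the constant does not depend on the dimension of
    the ambient space. *)
Lemma Kkk_free_ferrers_bound (R : realType) (k s : nat) :
  exists C : R, forall (T U : choiceType) (rs : seq (T -> U -> bool))
      (e : T -> U -> bool) (P : {fset T}) (Q : {fset U}),
    size rs = s ->
    (forall i, (i < size rs)%N -> ferrers (nth (fun _ _ => true) rs i)) ->
    (forall p q, p \in P -> q \in Q -> e p q = all (fun r => r p q) rs) ->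
    Kkk_free k P Q (edges e P Q) ->
    let n := (#|` P| + #|` Q|)%N in
    #|` edges e P Q|%:R <= C * n%:R * ln (n%:R : R) ^+ s.
Proof.
exists (k%:R * (2 / ln (2 : R)) ^+ s) => T U rs e P Q szs rF Ee free /=.
set n := (#|` P| + #|` Q|)%N.
have ln2 : 0 < ln (2 : R) by rewrite ln_gt0 // ltr1n.
have c_ge0 : 0 <= 2 / ln (2 : R) by rewrite divr_ge0 // ltW.
(* With at most one vertex some side is empty and there are no edges; the right-hand side is
   nonnegative since [ln 0] and [ln 1] are both 0. *)
have [n_le1|n_gt1] := leqP n 1.
  have : (#|` edges e P Q| <= 0)%N.
    by apply: leq_trans (card_edges_le _ _ _) _; move: n_le1; rewrite /n; nia.
  rewrite leqn0 => /eqP ->; rewrite !mulr_ge0 ?exprn_ge0 //.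
  by case: (n) n_le1 => [|[|]] // _; rewrite ?ln1 ?ln0.
have := card_edges_ferrers rF Ee free; rewrite szs -/n /= -(ler_nat R).
move/le_trans; apply; rewrite !natrM natrX.
rewrite [leRHS]mulrAC ler_wpM2r // -mulrA ler_wpM2l //.
rewrite -exprMn lerXn2r ?nnegrE //; last exact: trunc_logS_le_ln.
by rewrite mulr_ge0 // ln_ge0 // ler1n ltnW.
Qed.

(** * Interval endpoints and translated half-spaces give Ferrers relations *)

Lemma ferrers_total (T U : Type) (r : T -> U -> bool) :
  (forall q q', (forall p, r p q -> r p q') \/ (forall p, r p q' -> r p q)) ->
  ferrers r.
Proof.
move=> chain p p' q q' rpq rpq'.
by case: (chain q q') => sub; rewrite (sub _ _) ?orbT.
Qed.

(** The order on interval bounds is total and covers open, closed and infinite ends alike, so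
    lowering the left bound only enlarges the set of points. *)
Lemma ferrers_lower (R : realType) (T U : Type) (f : T -> R)
    (I : U -> interval R) :
  ferrers (fun p q => let: Interval l _ := I q in (l <= BLeft (f p))%O).
Proof.
apply: ferrers_total => q q'; case: (I q) (I q') => l u [l' u'].
by have /orP[ll'|ll'] := le_total l l'; [right|left] => p; apply: le_trans.
Qed.

Lemma ferrers_upper (R : realType) (T U : Type) (f : T -> R)
    (I : U -> interval R) :
  ferrers (fun p q => let: Interval _ u := I q in (BRight (f p) <= u)%O).
Proof.
apply: ferrers_total => q q'; case: (I q) (I q') => l u [l' u'].
by have /orP[uu'|uu'] := le_total u u'; [left|right] => p h; apply: le_trans uu'.
Qed.

Lemma dotB (R : realType) d (a x y : 'rV[R]_d) :
  dot a (x - y) = dot a x - dot a y.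
Proof.
by rewrite /dot -sumrB; apply: eq_bigr => i _; rewrite !mxE mulrBr.
Qed.

Lemma translateE (R : realType) d (y x : 'rV[R]_d) (H : set 'rV[R]_d) :
  translate y H x <-> H (x - y).
Proof.
split=> [[z Hz <-]|Hxy]; first by rewrite addrAC subrr add0r.
by exists (x - y); rewrite // addrC subrK.
Qed.

(** Membership of [p] in the translate compares [dot a p - dot a (y q)] with [b], so the translates
    are nested according to the single scalar [dot a (y q)]. *)
Lemma ferrers_translate (R : realType) d (U : Type) (H : set 'rV[R]_d)
    (y : U -> 'rV[R]_d) :
  is_halfspace H -> ferrers (fun p q => p \in translate (y q) H).
Proof.
move=> [a [b [_ HE]]]; apply: ferrers_total => q q'.
have [yy'|/ltW yy'] := leP (dot a (y q)) (dot a (y q')); [left|right] => p;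
  rewrite !in_setE => /translateE Hp; apply/translateE; move: Hp;
  case: HE => -> /=; rewrite !dotB.
- by apply: le_trans; rewrite lerD2l lerN2.
- by apply: le_lt_trans; rewrite lerD2l lerN2.
- by apply: le_trans; rewrite lerD2l lerN2.
- by apply: le_lt_trans; rewrite lerD2l lerN2.
Qed.

Lemma all_rel_ordP (T U : Type) s (r : 'I_s -> T -> U -> bool) p q :
  reflect (forall i, r i p q) (all (fun r => r p q) (map r (enum 'I_s))).
Proof.
rewrite (all_map r); apply: (iffP allP) => [rpq i|rpq i _]; last exact: rpq.
by apply: rpq; rewrite mem_enum.
Qed.

(** * Incidences with boxes and with intersections of translated half-spaces *)

Theorem mainTheorem2 (R : realType) :
  (forall d k : nat, exists C : R,
     forall (P : {fset 'rV[R]_d}) (B : {fset set 'rV[R]_d}),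
       (forall b, b \in B -> is_box b) ->
       Kkk_free k P B (incidence_graph P B) ->
       let n := (#|` P| + #|` B|)%N in
       #|` incidence_graph P B|%:R <= C * n%:R * ln (n%:R : R) ^+ (2 * d))
  /\
  (forall k s : nat, exists C : R,
     forall (d : nat) (H : 'I_s -> set 'rV[R]_d),
       (forall i, is_halfspace (H i)) ->
       forall (P : {fset 'rV[R]_d}) (F : {fset set 'rV[R]_d}),
         (forall f, f \in F -> polytope_family H f) ->
         Kkk_free k P F (incidence_graph P F) ->
         let n := (#|` P| + #|` F|)%N in
         #|` incidence_graph P F|%:R <= C * n%:R * ln (n%:R : R) ^+ s).
Proof.
split.
- move=> d k; have [C HC] := Kkk_free_ferrers_bound R k (2 * d).
  exists C => P B boxB free.
  have /choice[I HI] : forall b : set 'rV[R]_d, exists I : 'I_d -> interval R,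
      b \in B -> b = [set x | forall i, x 0 i \in I i].
    move=> b; have [/boxB[I bI]|_] := boolP (b \in B); first by exists I.
    (* An arbitrary value for sets outside [B], which makes [I] a total function. *)
    by exists (fun=> `]-oo, +oo[).
  pose lo i (p : 'rV[R]_d) (b : set 'rV[R]_d) :=
    let: Interval l _ := I b i in (l <= BLeft (p 0 i))%O.
  pose up i (p : 'rV[R]_d) (b : set 'rV[R]_d) :=
    let: Interval _ u := I b i in (BRight (p 0 i) <= u)%O.
  (* One relation per left end and one per right end: [2 * d] in total, whence the exponent. *)
  pose rs := map lo (enum 'I_d) ++ map up (enum 'I_d).
  apply: (HC _ _ rs (fun p b => p \in b)) free.
  + by rewrite size_cat (size_map lo) (size_map up) size_enum_ord mul2n addnn.
  + move=> i; rewrite size_cat (size_map lo) (size_map up) size_enum_ord => i_lt.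
    rewrite nth_cat (size_map lo) size_enum_ord; case: ltnP => di.
      by rewrite (nth_map (Ordinal di)) ?size_enum_ord //; apply: ferrers_lower.
    have di' : (i - d < d)%N by lia.
    by rewrite (nth_map (Ordinal di')) ?size_enum_ord //; apply: ferrers_upper.
  + move=> p b _ bB; rewrite all_cat.
    apply/idP/andP => [|[/all_rel_ordP plo /all_rel_ordP pup]].
      (* The set [b] also occurs on the right of [HI], inside [I b], so the rewriting is confined to
         the set applied to [p]. *)
      rewrite in_setE [X in X p](HI b bB) /= => pI.
      split; apply/all_rel_ordP => i; move: (pI i); rewrite /lo /up.
        by case: (I b i) => l u; rewrite itv_boundlr => /andP[].
      by case: (I b i) => l u; rewrite itv_boundlr => /andP[].
    rewrite in_setE [X in X p](HI b bB) /= => i; move: (plo i) (pup i).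
    by rewrite /lo /up; case: (I b i) => l u pl pu; rewrite itv_boundlr; apply/andP.
- move=> k s; have [C HC] := Kkk_free_ferrers_bound R k s.
  exists C => d H halfH P F famF free.
  have /choice[y Hy] : forall f : set 'rV[R]_d, exists y : 'I_s -> 'rV[R]_d,
      f \in F -> f = \bigcap_(i in [set: 'I_s]) translate (y i) (H i).
    move=> f; have [/famF[y fy]|_] := boolP (f \in F); first by exists y.
    by exists (fun=> 0).
  (* For each [i] the half-space [H i] is fixed and only the translation vector depends on [f];
     hence one Ferrers relation per index, [s] in total. *)
  pose r i (p : 'rV[R]_d) (f : set 'rV[R]_d) := p \in translate (y f i) (H i).
  apply: (HC _ _ (map r (enum 'I_s)) (fun p f => p \in f)) free.
  + by rewrite (size_map r) size_enum_ord.
  + move=> i; rewrite (size_map r) size_enum_ord => si.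
    rewrite (nth_map (Ordinal si)) ?size_enum_ord //.
    exact: ferrers_translate.
  + move=> p f _ fF; apply/idP/all_rel_ordP => [|pr].
      rewrite in_setE [X in X p](Hy f fF) => pf i.
      by rewrite /r in_setE; apply: pf.
    rewrite in_setE [X in X p](Hy f fF) => i _.
    by move: (pr i); rewrite /r in_setE.
Qed.
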